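(* Let $T\colon\mathbb{R}^n\to\mathbb{R}^n$ be Gâteaux differentiable and, for every $x\in\mathbb{R}^n$, let $\mathrm{J}_T(x)$ be the Jacobian of $T$ at $x$. Let $R_T=2T-\mathrm{I}$ be the reflected operator of $T$, let $\beta\in[0,+\infty[$, and, for every $x\in\mathbb{R}^n$, let $\rho_x\in[\overline{\lambda}_{\max}(\mathrm{J}^{\rm s}_{R_T}(x)),+\infty[$. The following properties are equivalent: (i) $T$ is $\beta$-strongly monotone; (ii) for every $x\in\mathbb{R}^n$, $\mathrm{J}^{\rm s}_T(x)\succeq\beta\,\mathrm{I}$; (iii) for every $x\in\mathbb{R}^n$, $\mathrm{J}^{\rm s}_{R_T}(x)\succeq(2\beta-1)\,\mathrm{I}$; (iv) for every $x\in\mathbb{R}^n$, $\rho_x-\overline{\lambda}_{\max}\big(\rho_x\mathrm{I}-\mathrm{J}^{\rm s}_{R_T}(x)\big)\ge 2\beta-1$. In addition, if these properties hold and $\beta>0$, then $T$ is invertible.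
   Context: $\mathbb{R}^n$ is Euclidean with norm $\|\cdot\|$ and inner product $\langle\cdot\mid\cdot\rangle$; $\mathrm{I}$ denotes the identity operator/matrix. If $T$ is Gâteaux differentiable at $x$, its Jacobian $\mathrm{J}_T(x)\in\mathbb{R}^{n\times n}$ is the matrix satisfying $\mathrm{J}_T(x)h=\lim_{t\to0,\,t\ne0}\frac{T(x+th)-T(x)}{t}$ for every $h\in\mathbb{R}^n$. Its symmetric part is $\mathrm{J}^{\rm s}_T(x)=(\mathrm{J}_T(x)+\mathrm{J}_T(x)^\top)/2$. For a symmetric matrix $M$, $\overline{\lambda}_{\max}(M)$ is the maximum of the absolute values of the eigenvalues of $M$. $M_1\succeq M_2$ means $u^\top M_1u\ge u^\top M_2u$ for every $u\in\mathbb{R}^n$. $T$ is $\beta$-strongly monotone if $\langle T(x)-T(y)\mid x-y\rangle\ge\beta\|x-y\|^2$ for all $x,y\in\mathbb{R}^n$; by convention $0$-strongly monotone means monotone. Invertible means bijective from $\mathbb{R}^n$ to $\mathbb{R}^n$. *)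

(* Defs.v *)
(* R^n is the space of column vectors ['cV[R]_n], over any [R : realType]. *)
From HB Require Import structures.
From mathcomp Require Import all_boot all_order all_algebra.
From mathcomp Require Import all_classical all_reals all_analysis.
Set Implicit Arguments.
Unset Strict Implicit.
Unset Printing Implicit Defensive.
Import Order.TTheory GRing.Theory Num.Theory.
Import numFieldNormedType.Exports.
Local Open Scope classical_set_scope.
Local Open Scope ring_scope.

(* The library norm [`|x|] on matrices is the max norm, so the Euclidean
   structure is introduced separately; both norms induce the same topology. *)
Definition dotp (R : realType) (n : nat) (x y : 'cV[R]_n) : R :=
  \sum_(i < n) x i 0 * y i 0.

Definition enorm (R : realType) (n : nat) (x : 'cV[R]_n) : R :=
  Num.sqrt (dotp x x).

(* For [beta = 0] this is plain monotonicity. *)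
Definition strongly_monotone (R : realType) (n : nat) (beta : R)
    (T : 'cV[R]_n -> 'cV[R]_n) : Prop :=
  forall x y : 'cV[R]_n,
    beta * enorm (x - y) ^+ 2 <= dotp (T x - T y) (x - y).

(* [is_derive x h T (J *m h)] says that [t^-1 *: (T (t *: h + x) - T x)]
   converges to [J *m h] as [t] tends to 0 with [t != 0]. *)
Definition is_gateaux_jacobian (R : realType) (n : nat)
    (T : 'cV[R]_n -> 'cV[R]_n) (x : 'cV[R]_n) (J : 'M[R]_n) : Prop :=
  forall h : 'cV[R]_n, is_derive x h T (J *m h).

Definition gateaux_differentiable (R : realType) (n : nat)
    (T : 'cV[R]_n -> 'cV[R]_n) : Prop :=
  forall x : 'cV[R]_n, exists J : 'M[R]_n, is_gateaux_jacobian T x J.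

(* The matrix satisfying [is_gateaux_jacobian T x], which is unique when it
   exists (junk value 0 otherwise). The library's [jacobian] is defined from the
   Frechet differential, hence is not usable here. *)
Definition gateaux_jacobian (R : realType) (n : nat)
    (T : 'cV[R]_n -> 'cV[R]_n) (x : 'cV[R]_n) : 'M[R]_n :=
  xget 0 [set J : 'M[R]_n | is_gateaux_jacobian T x J].

Definition sym_jacobian (R : realType) (n : nat)
    (T : 'cV[R]_n -> 'cV[R]_n) (x : 'cV[R]_n) : 'M[R]_n :=
  2^-1 *: (gateaux_jacobian T x + (gateaux_jacobian T x)^T).

Definition reflected (R : realType) (n : nat)
    (T : 'cV[R]_n -> 'cV[R]_n) (x : 'cV[R]_n) : 'cV[R]_n :=
  2 *: T x - x.

(* For a symmetric matrix of positive size the set is finite and nonempty, so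
   the supremum is a maximum. *)
Definition abs_lambda_max (R : realType) (n : nat) (M : 'M[R]_n) : R :=
  sup [set `|a| | a in [set a : R | eigenvalue M a]].

Definition loewner_ge (R : realType) (n : nat) (M1 M2 : 'M[R]_n) : Prop :=
  forall u : 'cV[R]_n, (u^T *m M2 *m u) 0 0 <= (u^T *m M1 *m u) 0 0.

(* Main.v *)
(* The derivative of [s |-> <T (s h + x) | k>] is [<J h | k>], [J] being taken
   at [s h + x]: difference quotients give (i) => (ii), and the mean value
   theorem gives (ii) => (i). As [J_{2T - I} = 2 J_T - I], (ii) <=> (iii) is
   linear. For (iii) <=> (iv), [rho I - M] is positive semidefinite, so its
   largest absolute eigenvalue is [rho - lambda_min M].

   For surjectivity, minimizing [|w|^2 + c] over the convex hull of the points
   [(beta y - S y, 4 beta <y | S y>)], where [S = T - beta I] is monotone,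
   yields [x] such that [beta |y - x|^2 <= <T y | y - x>] for all [y] (Minty). Letting
   [y] tend to [x] along the direction [- T x] gives [T x = 0]; this only uses
   the continuity of [T] along lines. *)
Require Import Defs.
From mathcomp Require Import all_boot all_order all_algebra.
From mathcomp Require Import all_classical all_reals all_analysis.
From mathcomp Require Import ring lra.
Set Implicit Arguments.
Unset Strict Implicit.
Unset Printing Implicit Defensive.
Import Order.TTheory GRing.Theory Num.Theory.
Import numFieldNormedType.Exports.
Local Open Scope classical_set_scope.
Local Open Scope ring_scope.

(** * Algebra of the Euclidean inner product *)

Lemma dotpC (R : realType) (n : nat) (x y : 'cV[R]_n) : dotp x y = dotp y x.
Proof. by apply: eq_bigr => i _; rewrite mulrC. Qed.

Lemma dotpDl (R : realType) (n : nat) (x y z : 'cV[R]_n) :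
  dotp (x + y) z = dotp x z + dotp y z.
Proof. by rewrite -big_split; apply: eq_bigr => i _; rewrite !mxE mulrDl. Qed.

Lemma dotpZl (R : realType) (n : nat) (a : R) (x y : 'cV[R]_n) :
  dotp (a *: x) y = a * dotp x y.
Proof. by rewrite mulr_sumr; apply: eq_bigr => i _; rewrite !mxE mulrA. Qed.

Lemma dotpNl (R : realType) (n : nat) (x y : 'cV[R]_n) :
  dotp (- x) y = - dotp x y.
Proof. by rewrite -scaleN1r dotpZl mulN1r. Qed.

Lemma dotpDr (R : realType) (n : nat) (x y z : 'cV[R]_n) :
  dotp x (y + z) = dotp x y + dotp x z.
Proof. by rewrite dotpC dotpDl !(dotpC x). Qed.

Lemma dotpZr (R : realType) (n : nat) (a : R) (x y : 'cV[R]_n) :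
  dotp x (a *: y) = a * dotp x y.
Proof. by rewrite dotpC dotpZl (dotpC x). Qed.

Lemma dotpNr (R : realType) (n : nat) (x y : 'cV[R]_n) :
  dotp x (- y) = - dotp x y.
Proof. by rewrite dotpC dotpNl (dotpC x). Qed.

Definition dotpE := (dotpDl, dotpDr, dotpNl, dotpNr, dotpZl, dotpZr).

Lemma dotp_ge0 (R : realType) (n : nat) (x : 'cV[R]_n) : 0 <= dotp x x.
Proof. by apply: sumr_ge0 => i _; rewrite -expr2 sqr_ge0. Qed.

Lemma sqr_coord_le_dotp (R : realType) (n : nat) (x : 'cV[R]_n) (i : 'I_n) :
  x i 0 ^+ 2 <= dotp x x.
Proof.
rewrite /dotp (bigD1 i) //= -expr2 lerDl.
by apply: sumr_ge0 => j _; rewrite -expr2 sqr_ge0.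
Qed.

Lemma dotp_le0 (R : realType) (n : nat) (x : 'cV[R]_n) : dotp x x <= 0 -> x = 0.
Proof.
move=> x0; apply/colP => i; rewrite mxE; apply/eqP; rewrite -sqrf_eq0.
by rewrite eq_le sqr_ge0 (le_trans (sqr_coord_le_dotp x i)).
Qed.

Lemma dotp_gt0 (R : realType) (n : nat) (x : 'cV[R]_n) :
  x != 0 -> 0 < dotp x x.
Proof. by move=> x0; rewrite ltNge; apply: contra_neqN x0 => /dotp_le0. Qed.

Lemma sqr_enorm (R : realType) (n : nat) (x : 'cV[R]_n) :
  enorm x ^+ 2 = dotp x x.
Proof. by rewrite sqr_sqrtr ?dotp_ge0. Qed.

(** * Quadratic forms *)

Lemma dotp_trmulmx (R : realType) (n : nat) (x y : 'cV[R]_n) :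
  dotp x y = (x^T *m y) 0 0.
Proof. by rewrite mxE; apply: eq_bigr => i _; rewrite mxE. Qed.

Lemma qformE (R : realType) (n : nat) (A : 'M[R]_n) (u : 'cV[R]_n) :
  (u^T *m A *m u) 0 0 = dotp u (A *m u).
Proof. by rewrite dotp_trmulmx mulmxA. Qed.

Lemma dotp_mulmx_tr (R : realType) (n : nat) (A : 'M[R]_n) (x y : 'cV[R]_n) :
  dotp (A *m x) y = dotp x (A^T *m y).
Proof. by rewrite !dotp_trmulmx trmx_mul mulmxA. Qed.

Lemma qform_sym_part (R : realType) (n : nat) (A : 'M[R]_n) (u : 'cV[R]_n) :
  dotp u ((2^-1 *: (A + A^T)) *m u) = dotp u (A *m u).
Proof.
rewrite -scalemxAl mulmxDl !dotpE -dotp_mulmx_tr (dotpC (A *m u)).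
by field.
Qed.

Lemma qform_scalar (R : realType) (n : nat) (a : R) (u : 'cV[R]_n) :
  dotp u (a%:M *m u) = a * dotp u u.
Proof. by rewrite mul_scalar_mx dotpZr. Qed.

Lemma qform_bounded (R : realType) (n : nat) (A : 'M[R]_n) :
  exists2 K : R, 0 < K &
    forall u : 'cV[R]_n, `|dotp u (A *m u)| <= K * dotp u u.
Proof.
(* The summand 1 keeps the constant positive when [A] is 0; the double sum suffices since
   [|u_i| |u_j| <= dotp u u]. *)
exists (1 + \sum_i \sum_j `|A i j|).
  by rewrite ltr_pwDl //; do 2!apply: sumr_ge0 => ? _.
move=> u; rewrite mulrDl mul1r; apply: ler_wpDl; first exact: dotp_ge0.
rewrite mulr_suml; apply: le_trans (ler_norm_sum _ _ _) _.
apply: ler_sum => i _; rewrite normrM mxE mulr_suml.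
apply: le_trans (ler_wpM2l (normr_ge0 _) (ler_norm_sum _ _ _)) _.
rewrite mulr_sumr; apply: ler_sum => j _; rewrite normrM mulrCA.
apply: ler_wpM2l => //.
have ui := sqr_coord_le_dotp u i; have uj := sqr_coord_le_dotp u j.
rewrite -real_normK ?num_real // in ui; rewrite -real_normK ?num_real // in uj.
have := sqr_ge0 (`|u i 0| - `|u j 0|); nra.
Qed.

(* A positive semidefinite invertible symmetric matrix dominates a positive
   multiple of the identity, by the Cauchy-Schwarz inequality for its form. *)
Lemma psd_unitmx_coercive (R : realType) (n : nat) (A : 'M[R]_n) :
  A^T = A -> A \in unitmx -> (forall u : 'cV[R]_n, 0 <= dotp u (A *m u)) ->
  exists2 c : R, 0 < c & forall u : 'cV[R]_n, c * dotp u u <= dotp u (A *m u).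
Proof.
move=> Asym Aunit Apsd.
have [K K0 HK] := qform_bounded A.
have [L L0 HL] := qform_bounded ((invmx A)^T *m invmx A).
have KL0 : 0 < K * L by rewrite mulr_gt0.
exists (K * L)^-1; first by rewrite invr_gt0.
move=> u; rewrite ler_pdivrMl //.
set v := A *m u.
have uv : dotp u u <= L * dotp v v.
  have := HL v; rewrite -mulmxA -dotp_mulmx_tr -{1 2}[u](mulKmx Aunit).
  by apply: le_trans; rewrite ler_norm.
have vv : dotp v v <= K * dotp u v.
  (* Expanding the form at [K u - v] gives [0 <= K^2 <u|v> - 2 K |v|^2 + <v|A v>], whose last term
     is at most [K |v|^2]; then divide by [K]. *)
  have := Apsd (K *: u - v).
  rewrite mulmxBr -scalemxAr -/v !dotpE.
  have -> : dotp u (A *m v) = dotp v v by rewrite -{1}Asym -dotp_mulmx_tr.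
  have := HK v; rewrite ler_norml => /andP[_].
  have := dotp_ge0 v; nra.
by rewrite -mulrA mulrCA; apply: le_trans uv _; rewrite ler_pM2l.
Qed.

(** * Eigenvalues of symmetric matrices *)

Lemma eigenvalue_unitmx (F : fieldType) (n : nat) (A : 'M[F]_n) (a : F) :
  eigenvalue A a = (A - a%:M \notin unitmx).
Proof. by rewrite /eigenvalue /eigenspace kermx_eq0 row_free_unit. Qed.

(** Eigenvectors for [eigenvalue] are rows; by symmetry, transposing them gives columns, which fit
    the quadratic form. *)
Lemma sym_eigenvalueP (R : realType) (n : nat) (A : 'M[R]_n) (a : R) :
  A^T = A ->
  eigenvalue A a <-> exists2 u : 'cV[R]_n, A *m u = a *: u & 0 < dotp u u.
Proof.
move=> Asym; split=> [/eigenvalueP[v va v0]|[u Au u0]].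
  exists v^T; first by rewrite -[in LHS]Asym -trmx_mul va linearZ.
  apply: dotp_gt0; apply: contra_neq v0 => /(congr1 trmx).
  by rewrite trmxK trmx0.
apply/eigenvalueP; exists u^T.
  by rewrite -[in LHS]Asym -trmx_mul Au linearZ.
apply: contraTneq u0 => /(congr1 trmx); rewrite trmxK trmx0 => ->.
by rewrite dotp_trmulmx mulmx0 mxE ltxx.
Qed.

(* The eigenvalue is the infimum of the Rayleigh quotient. *)
Lemma sym_min_eigenvalue (R : realType) (n : nat) (A : 'M[R]_n) :
  (0 < n)%N -> A^T = A ->
  exists2 a : R, eigenvalue A a &
    forall u : 'cV[R]_n, a * dotp u u <= dotp u (A *m u).
Proof.
case: n A => // n A _ Asym.
pose Q := [set dotp u (A *m u) / dotp u u |
  u in [set u : 'cV[R]_n.+1 | u != 0]].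
have Q0 : Q !=set0.
  pose u : 'cV[R]_n.+1 := const_mx 1.
  exists (dotp u (A *m u) / dotp u u), u => //=.
  by apply/eqP => /colP/(_ 0)/eqP; rewrite !mxE oner_eq0.
have [K K0 HK] := qform_bounded A.
have Qlb : has_lbound Q.
  exists (- K) => _ [u /= u0 <-]; rewrite ler_pdivlMr ?dotp_gt0 //.
  by have := HK u; rewrite ler_norml mulNr => /andP[].
have Qinf u : inf Q * dotp u u <= dotp u (A *m u).
  have [->|u0] := eqVneq u 0; first by rewrite !dotp_trmulmx !mulmx0 !mxE mulr0.
  by rewrite -ler_pdivlMr ?dotp_gt0 //; apply: ge_inf => //; exists u.
exists (inf Q) => //; rewrite eigenvalue_unitmx; apply/negP => Aunit.
(* If [A - inf Q] were invertible, coercivity would make [inf Q + c] a lower bound of [Q]. *)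
have [||c c0 Hc] := psd_unitmx_coercive _ Aunit.
- by rewrite linearB /= tr_scalar_mx Asym.
- by move=> u; rewrite mulmxBl dotpDr dotpNr qform_scalar subr_ge0.
have [_ [u /= u0 <-]] := inf_adherent c0 (conj Q0 Qlb).
apply/negP; rewrite -leNgt ler_pdivlMr ?dotp_gt0 // mulrDl addrC -lerBrDr.
by have := Hc u; rewrite mulmxBl dotpDr dotpNr qform_scalar.
Qed.

(** A bound of the quadratic form, tested on eigenvectors, bounds the spectrum, so the [sup] is a
    genuine upper bound and not a default value. *)
Lemma abs_lambda_max_ub (R : realType) (n : nat) (A : 'M[R]_n) (a : R) :
  A^T = A -> eigenvalue A a -> `|a| <= abs_lambda_max A.
Proof.
move=> Asym ea; apply: ub_le_sup; last by exists a.
have [K K0 HK] := qform_bounded A.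
exists K => _ [b /= eb <-]; have [u Au u0] := (sym_eigenvalueP b Asym).1 eb.
by have := HK u; rewrite Au dotpZr normrM (gtr0_norm u0) ler_pM2r.
Qed.

(** The spectrum of [r I - A] is that of [A] under [a |-> r - a]. In size 0 the [sup] is over the
    empty set, hence 0, and the right-hand side would become [c <= r], which can fail. *)
Lemma loewner_ge_abs_lambda_max (R : realType) (n : nat) (A : 'M[R]_n)
    (c r : R) :
  (0 < n)%N -> A^T = A -> abs_lambda_max A <= r ->
  loewner_ge A c%:M <-> c <= r - abs_lambda_max (r%:M - A).
Proof.
move=> n0 Asym rA.
have Bsym : (r%:M - A)^T = r%:M - A by rewrite linearB /= tr_scalar_mx Asym.
have Bu u : (r%:M - A) *m u = r *: u - A *m u by rewrite mulmxBl mul_scalar_mx.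
split=> [Ac|cr u].
- rewrite lerBrDr addrC -lerBrDr.
  have [a ea _] := sym_min_eigenvalue n0 Bsym.
  apply: ge_sup; first by exists `|a|, a.
  move=> _ [{ea}a /= ea <-].
  have [u Bau u0] := (sym_eigenvalueP a Bsym).1 ea.
  have Au : A *m u = (r - a) *: u.
    by rewrite scalerBl -Bau Bu opprB addrC subrK.
  have era : eigenvalue A (r - a).
    by apply/(sym_eigenvalueP _ Asym); exists u.
  (* The bound [rA] puts the eigenvalue [r - a] of [A] below [r], so that [|a| = a]. *)
  have a0 : 0 <= a.
    have := le_trans (abs_lambda_max_ub Asym era) rA.
    by rewrite ler_norml => /andP[_]; rewrite gerBl.
  have := Ac u; rewrite !qformE qform_scalar Au dotpZr ler_pM2r // ger0_norm //.
  by rewrite lerBrDr addrC -lerBrDr.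
(* Conversely, with [a] the least eigenvalue of [A], [r - a] is an eigenvalue of [r I - A], whence
   [c <= a]. *)
- have [a ea Ha] := sym_min_eigenvalue n0 Asym.
  have [v Av v0] := (sym_eigenvalueP a Asym).1 ea.
  have era : eigenvalue (r%:M - A) (r - a).
    by apply/(sym_eigenvalueP _ Bsym); exists v; rewrite // Bu Av scalerBl.
  have := le_trans (ler_norm _) (abs_lambda_max_ub Bsym era).
  rewrite !qformE qform_scalar => h; apply: le_trans (Ha u).
  by rewrite ler_wpM2r ?dotp_ge0 //; lra.
Qed.

(** * Limits and Gateaux derivatives along lines *)

Lemma cvg_dotp (R : realType) (n : nat) (I : Type) (F : set_system I)
    {FF : Filter F} (f g : I -> 'cV[R]_n) (a b : 'cV[R]_n) :
  f @ F --> a -> g @ F --> b -> dotp (f x) (g x) @[x --> F] --> dotp a b.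
Proof.
move=> fa gb; apply: cvg_big => [|i _]; first exact: add_continuous.
have coord (u : I -> 'cV[R]_n) (c : 'cV[R]_n) :
    u @ F --> c -> u x i 0 @[x --> F] --> c i 0.
  move=> uc; apply: (@cvg_comp _ _ _ u (fun M : 'cV[R]_n => M i 0) _ _ _ uc).
  exact: coord_continuous.
by apply: cvgM; apply: coord.
Qed.

Lemma cvg_ge_near (R : realType) (I : Type) (F : set_system I)
    {FF : ProperFilter F} (f : I -> R) (a c : R) :
  f @ F --> a -> (\forall x \near F, c <= f x) -> c <= a.
Proof.
move=> fa cf; apply: (closed_cvg (fun r => c <= r)) cf _ fa.
exact: closed_ge.
Qed.

(** Uniqueness: the columns of a Jacobian are the derivatives along the basis vectors. *)
Lemma gateaux_jacobianP (R : realType) (n : nat) (T : 'cV[R]_n -> 'cV[R]_n)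
    (x : 'cV[R]_n) (J : 'M[R]_n) :
  is_gateaux_jacobian T x J -> gateaux_jacobian T x = J.
Proof.
move=> TJ; have TJ' : is_gateaux_jacobian T x (gateaux_jacobian T x).
  by apply: xgetPex; exists J.
apply/trmx_inj/row_matrixP => i; apply: trmx_inj; rewrite !tr_row !trmxK !colE.
rewrite -(@derive_val _ _ _ _ _ _ _ (TJ' _)).
exact: (@derive_val _ _ _ _ _ _ _ (TJ _)).
Qed.

Lemma gateaux_differentiableP (R : realType) (n : nat)
    (T : 'cV[R]_n -> 'cV[R]_n) (x : 'cV[R]_n) :
  gateaux_differentiable T -> is_gateaux_jacobian T x (gateaux_jacobian T x).
Proof. by move=> /(_ x)[J TJ]; rewrite (gateaux_jacobianP TJ). Qed.

Lemma sym_jacobian_reflected (R : realType) (n : nat)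
    (T : 'cV[R]_n -> 'cV[R]_n) (x : 'cV[R]_n) :
  gateaux_differentiable T ->
  sym_jacobian (reflected T) x = 2 *: sym_jacobian T x - 1%:M.
Proof.
move=> dT; rewrite /sym_jacobian.
rewrite (@gateaux_jacobianP _ _ (reflected T) x
  (2 *: gateaux_jacobian T x - 1%:M)).
  rewrite linearB /= linearZ /= tr_scalar_mx.
  apply/matrixP => i j; rewrite !mxE.
  by field.
move=> h; have Th := gateaux_differentiableP x dT h.
by rewrite mulmxBl mul1mx -scalemxAl; apply: is_deriveB.
Qed.

Lemma sym_jacobian_sym (R : realType) (n : nat)
    (T : 'cV[R]_n -> 'cV[R]_n) (x : 'cV[R]_n) :
  (sym_jacobian T x)^T = sym_jacobian T x.
Proof. by rewrite linearZ linearD /= trmxK addrC. Qed.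

Lemma cvg_dotp_quotient (R : realType) (n : nat) (T : 'cV[R]_n -> 'cV[R]_n)
    (x h k : 'cV[R]_n) (J : 'M[R]_n) :
  is_gateaux_jacobian T x J ->
  s^-1 * (dotp (T (s *: h + x)) k - dotp (T x) k) @[s --> 0^'] -->
    dotp (J *m h) k.
Proof.
move=> /(_ h)[dT <-].
under eq_fun do rewrite -dotpNl -dotpDl -dotpZl.
apply: cvg_dotp; [exact: dT|exact: cvg_cst].
Qed.

Lemma is_derive_line (R : realType) (n : nat) (T : 'cV[R]_n -> 'cV[R]_n)
    (x h k : 'cV[R]_n) (t : R) :
  gateaux_differentiable T ->
  is_derive t 1 (fun s => dotp (T (s *: h + x)) k)
    (dotp (gateaux_jacobian T (t *: h + x) *m h) k).
Proof.
move=> /(gateaux_differentiableP (t *: h + x)) TJ.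
have lim : (fun s => s^-1 *: (((fun s => dotp (T (s *: h + x)) k) \o shift t)
    (s *: 1) - dotp (T (t *: h + x)) k)) @ 0^' -->
    dotp (gateaux_jacobian T (t *: h + x) *m h) k.
  (* An increment [s] at [t] moves the base point [t h + x] by [s h]. *)
  under eq_fun do rewrite /= [_ *: 1]mulr1 scalerDl -addrA.
  exact: cvg_dotp_quotient.
by split; [apply/cvg_ex; eexists; exact: lim|exact: cvg_lim lim].
Qed.

Lemma continuous_line (R : realType) (n : nat) (T : 'cV[R]_n -> 'cV[R]_n)
    (x h k : 'cV[R]_n) :
  gateaux_differentiable T -> continuous (fun s : R => dotp (T (s *: h + x)) k).
Proof.
move=> dT t; apply/differentiable_continuous/derivable1_diffP.
exact: (@ex_derive _ _ _ _ _ _ _ (is_derive_line _ _ _ _ dT)).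
Qed.

(** * Strong monotonicity and the Jacobian *)

Lemma strongly_monotone_sym_jacobian (R : realType) (n : nat)
    (T : 'cV[R]_n -> 'cV[R]_n) (beta : R) :
  gateaux_differentiable T ->
  strongly_monotone beta T <->
  (forall x, loewner_ge (sym_jacobian T x) beta%:M).
Proof.
move=> dT; split=> [Tmon x h|TJ x y].
- rewrite !qformE qform_scalar qform_sym_part (dotpC _ (_ *m _)).
  apply: (cvg_ge_near (cvg_dotp_quotient (gateaux_differentiableP x dT))).
  near=> s; have s0 : s != 0 by near: s; exact: nbhs_dnbhs_neq.
  have := Tmon (s *: h + x) x; rewrite sqr_enorm addrK !dotpE => Ts.
  (* Multiplying by [s^2] rather than by [s] treats both signs of [s] at once. *)
  have s2 : 0 < s * s by rewrite -expr2 exprn_even_gt0.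
  rewrite -(ler_pM2l s2) mulrCA !mulrA mulfK //; lra.
- rewrite sqr_enorm.
  have [||c _ E] := @MVT _ (fun s => dotp (T (s *: (x - y) + y)) (x - y))
    (fun s => dotp (gateaux_jacobian T (s *: (x - y) + y) *m (x - y)) (x - y))
    0 1 ltr01.
  + by move=> s _; exact: is_derive_line.
  + exact/continuous_subspaceT/continuous_line.
  move: E; rewrite subr0 mulr1 scale1r scale0r add0r subrK -dotpNl -dotpDl.
  move=> ->.
  have := TJ (c *: (x - y) + y) (x - y).
  by rewrite !qformE qform_scalar qform_sym_part (dotpC _ (_ *m _)).
Unshelve. all: by end_near. Qed.

(** * Surjectivity by convex minimization *)

Lemma cauchy_dotp_cvg (R : realType) (n : nat) (u : nat -> 'cV[R]_n) :
  (forall e : R, 0 < e ->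
     \forall k & l \near \oo, dotp (u k - u l) (u k - u l) < e) ->
  cvg (u @ \oo).
Proof.
move=> ucauchy; apply: cauchy_cvg; apply/(cauchy_ballP (u @ \oo)) => e e0.
have e2 : 0 < e ^+ 2 by rewrite exprn_gt0.
(* Each coordinate is bounded by the Euclidean norm, so the sequence is Cauchy for the max norm,
   which is complete. *)
rewrite near_simpl; apply: filterS (ucauchy _ e2) => -[k l] /= ukl.
split=> // i j; rewrite ord1 /ball /= -ltr_sqr ?nnegrE ?(ltW e0) //.
rewrite real_normK ?num_real //; apply: le_lt_trans ukl.
by have := sqr_coord_le_dotp (u k - u l) i; rewrite !mxE.
Qed.

(* Minimize [p |-> |p.1|^2 + p.2] over the convex set: minimizing sequences are
   Cauchy in [p.1], and the inequality is the first-order optimality condition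
   at their limit. *)
Lemma convex_first_order (R : realType) (n : nat)
    (C : set ('cV[R]_n * R^o)) :
  C !=set0 ->
  (forall (t : R) p q, 0 <= t -> t <= 1 -> C p -> C q ->
     C ((1 - t) *: p + t *: q)) ->
  (forall p, C p -> 0 <= dotp p.1 p.1 + p.2) ->
  exists w : 'cV[R]_n, forall p, C p -> 0 <= 2 * dotp w p.1 - dotp w w + p.2.
Proof.
move=> [p0 Cp0] Cconv Cpos.
pose E (p : 'cV[R]_n * R^o) : R := dotp p.1 p.1 + p.2.
pose I := [set E p | p in C].
have I0 : I !=set0 by exists (E p0), p0.
have Ilb : has_lbound I by exists 0 => _ [p Cp <-]; exact: Cpos.
have Iinf p : C p -> inf I <= E p by move=> Cp; apply: ge_inf => //; exists p.
(* The excess over the infimum is squared so that, after mixing with weight [harmonic k] and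
   dividing by it, the error still vanishes. *)
have /choice[p pP] (k : nat) : exists p, C p /\ E p < inf I + harmonic k ^+ 2.
  have hk : 0 < (harmonic k : R) ^+ 2 by rewrite exprn_gt0 // invr_gt0.
  by have [_ [p Cp <-] Ep] := inf_adherent hk (conj I0 Ilb); exists p.
have Emix (t : R) q r : E ((1 - t) *: q + t *: r) = (1 - t) * E q + t * E r
    - t * (1 - t) * dotp (q.1 - r.1) (q.1 - r.1).
  rewrite /E /= !dotpE (dotpC r.1) /GRing.scale /=; ring.
have harm0 : (harmonic k : R) ^+ 2 @[k --> \oo] --> (0 : R).
  rewrite -[0 in X in _ --> X](mul0r (0 : R)).
  by apply: cvgM; exact: cvg_harmonic.
have : cvg ((fun k => (p k).1) @ \oo).
  apply: cauchy_dotp_cvg => e e0.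
  have e4 : 0 < e / 4 by rewrite divr_gt0.
  have small : \forall k \near \oo, (harmonic k : R) ^+ 2 < e / 4.
    exact: (cvgr_lt _ harm0).
  near=> k l.
  have [[Ck Ek] [Cl El]] := (pP k, pP l).
  have hk : (harmonic k : R) ^+ 2 < e / 4 by near: k.
  have hl : (harmonic l : R) ^+ 2 < e / 4 by near: l.
  (* At the midpoint, [Emix] bounds the squared distance by twice the sum of the two excesses. *)
  have := Iinf _ (Cconv 2^-1 _ _ _ _ Ck Cl); rewrite Emix.
  lra.
move=> /cvg_ex[w pw]; exists w => q Cq.
(* By polarization [f k] is [E q - d + h (1 + d)], where [d] is the squared distance from [(p k).1]
   to [q.1] and [h = harmonic k]. Optimality against the mixture of weight [h] puts it above
   [E (p k)], which is nonnegative. *)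
pose f k : R := 2 * dotp (p k).1 q.1 - dotp (p k).1 (p k).1 + q.2
  + harmonic k * (1 + dotp ((p k).1 - q.1) ((p k).1 - q.1)).
have fcvg : f @ \oo --> 2 * dotp w q.1 - dotp w w + q.2
    + 0 * (1 + dotp (w - q.1) (w - q.1)).
  apply: cvgD; last first.
    apply: cvgM; first exact: cvg_harmonic.
    apply: cvgD; first exact: cvg_cst.
    by apply: cvg_dotp; apply: cvgB => //; exact: cvg_cst.
  apply: cvgD; last exact: cvg_cst.
  apply: cvgB; last exact: cvg_dotp.
  by apply: cvgM; [exact: cvg_cst|apply: cvg_dotp => //; exact: cvg_cst].
rewrite mul0r addr0 in fcvg.
apply: (cvg_ge_near fcvg); apply: nearW => k; rewrite /f.
have [Ck Ek] := pP k; have := Cpos _ Ck.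
set h := harmonic k in Ek *.
have h0 : 0 < h by rewrite invr_gt0.
have h1 : h <= 1 by rewrite invf_le1 ?ler1n.
have := Iinf _ (Cconv h _ _ (ltW h0) h1 Ck Cq); rewrite Emix.
set d := dotp ((p k).1 - q.1) _.
have -> : dotp (p k).1 q.1 = (dotp (p k).1 (p k).1 + dotp q.1 q.1 - d) / 2.
  by rewrite /d !dotpE (dotpC q.1); field.
rewrite /E in Ek * => Einf Epos.
rewrite -(pmulr_rge0 _ h0); nra.
Unshelve. all: by end_near. Qed.

(* The convex set of [convex_first_order] is a linear image of the bipolar of
   the graph of [T - beta I] with respect to the relation [B], which is affine
   in each argument; it plays the role of the convex hull of the points
   [((y, S y), <y | S y>)]. *)
Lemma minty_point (R : realType) (n : nat) (T : 'cV[R]_n -> 'cV[R]_n)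
    (beta : R) :
  0 < beta -> strongly_monotone beta T ->
  exists x, forall y, beta * dotp (y - x) (y - x) <= dotp (T y) (y - x).
Proof.
move=> beta0 Tmon.
pose S y := T y - beta *: y.
pose g y : 'cV[R]_n * 'cV[R]_n * R^o := (y, S y, dotp y (S y)).
pose B (p q : 'cV[R]_n * 'cV[R]_n * R^o) :=
  dotp p.1.1 q.1.2 + dotp q.1.1 p.1.2 <= p.2 + q.2.
have Bsym p q : B p q -> B q p by rewrite /B addrC [leRHS]addrC.
have Bconv (t : R) p q r : 0 <= t -> t <= 1 -> B p r -> B q r ->
    B ((1 - t) *: p + t *: q) r.
  by rewrite /B /= !dotpE /GRing.scale /= => t0 t1 pr qr; nra.
(* Unfolded, this is [0 <= <x - y | S x - S y>]. *)
have Bg x y : B (g x) (g y).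
  have := Tmon x y; rewrite sqr_enorm /B /= /S !dotpE.
  rewrite !(dotpC (T x)) !(dotpC (T y)) (dotpC y x); lra.
pose P := [set p | forall y, B p (g y)].
(* Requiring [P p] as well makes [B p p] available, that is [<p.1.1 | p.1.2> <= p.2]. *)
pose PP := [set p | P p /\ forall q, P q -> B p q].
have PPg y : PP (g y) by split=> [z //|q Pq]; exact/Bsym/Pq.
pose L (p : 'cV[R]_n * 'cV[R]_n * R^o) : 'cV[R]_n * R^o :=
  (beta *: p.1.1 - p.1.2, 4 * beta * p.2).
have [|||w Hw] := @convex_first_order _ _ (L @` PP).
- by exists (L (g 0)), (g 0).
- move=> t _ _ t0 t1 [p [Pp PPp] <-] [q [Pq PPq] <-].
  exists ((1 - t) *: p + t *: q).
    by split=> [y|r Pr]; apply: Bconv => //; auto.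
  congr pair; last by rewrite /= /GRing.scale /=; ring.
  by rewrite /= !scalerBr !scalerDr !scalerA opprD addrACA ![_ * beta]mulrC.
- move=> _ [p [Pp PPp] <-] /=.
  have := PPp _ Pp; rewrite /B => Bpp.
  (* By [B p p], [|beta x - v|^2 + 4 beta p.2] is at least [|beta x + v|^2], for [x = p.1.1] and
     [v = p.1.2]. *)
  have := dotp_ge0 (beta *: p.1.1 + p.1.2).
  rewrite !dotpE (dotpC p.1.2); nra.
(* With this scaling, the inequality for [L (g y)] is exactly [4 beta] times the claim. *)
exists ((2 * beta)^-1 *: w) => y.
have /= := Hw _ (imageP L (PPg y)).
rewrite /S !dotpE (dotpC y w) (dotpC y (T y)) (dotpC (T y) w) => Hwy.
have b4 : 0 < 4 * beta by rewrite mulr_gt0.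
rewrite -(ler_pM2l b4) -subr_ge0; apply: le_trans Hwy _.
by rewrite le_eqVlt; apply/orP; left; apply/eqP; field; rewrite gt_eqF.
Qed.

Lemma strongly_monotone_bijective (R : realType) (n : nat)
    (T : 'cV[R]_n -> 'cV[R]_n) (beta : R) :
  gateaux_differentiable T -> 0 < beta -> strongly_monotone beta T ->
  bijective T.
Proof.
move=> dT beta0 Tmon.
have Tsurj z : exists x, T x = z.
  (* Translation reduces solving [T x = z] to finding a zero. *)
  have Tzmon : strongly_monotone beta (fun x => T x - z).
    by move=> x y; rewrite opprB addrA subrK.
  have [x Hx] := minty_point beta0 Tzmon.
  exists x; apply/eqP; rewrite -subr_eq0 -oppr_eq0; apply/eqP/dotp_le0.
  set h := - (T x - z).
  suff : 0 <= dotp (T x - z) h by rewrite -[T x - z]opprK -/h dotpNl oppr_ge0.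
  have C : dotp (T (s *: h + x) - z) h @[s --> 0^'+] --> dotp (T x - z) h.
    under eq_fun do rewrite dotpDl; rewrite dotpDl.
    apply: cvgD; last exact: cvg_cst.
    rewrite -[in X in _ --> X](add0r x) -[in X in _ --> X](scale0r h).
    apply: cvg_at_right_filter; exact: continuous_line.
  apply: (cvg_ge_near C); near=> s.
  have s0 : 0 < s by near: s; exact: nbhs_right_gt.
  (* Here [y - x = s h]; dividing by [s > 0] leaves a nonnegative inner product with [h]. *)
  have := Hx (s *: h + x); rewrite addrK [leRHS]dotpZr => sh.
  rewrite -(pmulr_rge0 _ s0); apply: le_trans sh.
  by rewrite mulr_ge0 ?dotp_ge0 // ltW.
have [g gK] := choice Tsurj.
exists g => // x.
(* Injectivity: [g (T x)] and [x] have the same image, so their squared distance is at most 0. *)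
have := Tmon (g (T x)) x; rewrite gK subrr sqr_enorm -(scale0r 0) dotpZl mul0r.
by rewrite pmulr_rle0 // => /dotp_le0/eqP; rewrite subr_eq0 => /eqP.
Unshelve. all: by end_near. Qed.

Theorem proposition3p3 (R : realType) (n : nat) (n_gt0 : (0 < n)%N)
    (T : 'cV[R]_n -> 'cV[R]_n) (T_diff : gateaux_differentiable T)
    (beta : R) (beta_ge0 : 0 <= beta)
    (rho : 'cV[R]_n -> R)
    (rho_ge : forall x : 'cV[R]_n,
       abs_lambda_max (sym_jacobian (reflected T) x) <= rho x) :
  [/\ strongly_monotone beta T <->
        (forall x : 'cV[R]_n, loewner_ge (sym_jacobian T x) beta%:M),
      strongly_monotone beta T <->
        (forall x : 'cV[R]_n,
           loewner_ge (sym_jacobian (reflected T) x) (2 * beta - 1)%:M),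
      strongly_monotone beta T <->
        (forall x : 'cV[R]_n,
           2 * beta - 1 <=
             rho x - abs_lambda_max
                       ((rho x)%:M - sym_jacobian (reflected T) x))
    & strongly_monotone beta T -> 0 < beta -> bijective T].
Proof.
have mon_refl : strongly_monotone beta T <-> (forall x,
    loewner_ge (sym_jacobian (reflected T) x) (2 * beta - 1)%:M).
  apply: iff_trans (strongly_monotone_sym_jacobian beta T_diff) _.
  split=> TJ x u; have := TJ x u;
    rewrite !qformE !qform_scalar sym_jacobian_reflected // mulmxBl mul1mx
      -(scalemxAl 2 (sym_jacobian T x)) !dotpE; lra.
split=> //.
- exact: strongly_monotone_sym_jacobian.
- apply: iff_trans mon_refl _.
  have eqv x := loewner_ge_abs_lambda_max (2 * beta - 1) n_gt0
    (sym_jacobian_sym (reflected T) x) (rho_ge x).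
  by split=> TJ x; apply/eqv.
- by move=> Tmon beta_gt0; exact: strongly_monotone_bijective Tmon.
Qed.
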